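(* There exists a compact porous subset $X\subset\mathbb{H}$ that does not admit a bi-Lipschitz embedding into $\ell_2$.
   Context: The Heisenberg group $\mathbb{H}$ is $\mathbb{R}^3$ with group law $(x,y,z)\cdot(x',y',z')=(x+x',y+y',z+z'+\tfrac12(xy'-x'y))$, equipped with the Korányi metric $d_K(p,q)=\big(((x-x')^2+(y-y')^2)^2+16(z-z'+\tfrac12(xy'-x'y))^2\big)^{1/4}$ (equivalently, up to bi-Lipschitz change, the Carnot–Carathéodory metric). A subset $E$ of a metric space $Z$ is porous if there is $c\ge1$ such that for every $x\in E$ and every $r>0$ the set $B(x,r)\setminus E$ contains a ball of radius $r/c$. A bi-Lipschitz embedding is a map $f$ with $L^{-1}d(a,b)\le\|f(a)-f(b)\|\le Ld(a,b)$ for some $L\ge1$. *)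

(* Defs.v *)
From Stdlib Require Import Reals List.
From Coquelicot Require Import Coquelicot.
Open Scope R_scope.

Definition Hpt : Type := (R * R * R)%type.

Definition Hmul (p q : Hpt) : Hpt :=
  let '(x, y, z) := p in let '(x', y', z') := q in
  (x + x', y + y', z + z' + / 2 * (x * y' - x' * y)).

Definition dK (p q : Hpt) : R :=
  let '(x, y, z) := p in let '(x', y', z') := q in
  sqrt (sqrt (((x - x') ^ 2 + (y - y') ^ 2) ^ 2
              + 16 * (z - z' + / 2 * (x * y' - x' * y)) ^ 2)).

Definition Hball (p : Hpt) (r : R) (q : Hpt) : Prop := dK p q < r.

Definition Hopen (U : Hpt -> Prop) : Prop :=
  forall p, U p -> exists r, 0 < r /\ forall q, Hball p r q -> U q.

Definition Hcompact (X : Hpt -> Prop) : Prop :=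
  forall (I : Type) (U : I -> Hpt -> Prop),
    (forall i, Hopen (U i)) ->
    (forall p, X p -> exists i, U i p) ->
    exists l : list I, forall p, X p -> exists i, In i l /\ U i p.

Definition Hporous (E : Hpt -> Prop) : Prop :=
  exists c, 1 <= c /\
    forall x, E x -> forall r, 0 < r ->
      exists y, forall q, Hball y (r / c) q -> Hball x r q /\ ~ E q.

Definition in_l2 (u : nat -> R) : Prop := ex_series (fun n => (u n) ^ 2).

Definition l2dist (u v : nat -> R) : R :=
  sqrt (Series (fun n => (u n - v n) ^ 2)).

Definition bilip_embed_l2 (X : Hpt -> Prop) (f : Hpt -> nat -> R) : Prop :=
  (forall p, X p -> in_l2 (f p)) /\
  exists L, 1 <= L /\
    forall a b, X a -> X b ->
      / L * dK a b <= l2dist (f a) (f b) /\ l2dist (f a) (f b) <= L * dK a b.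

(* Main.v *)
Require Import Defs.
From Stdlib Require Import Reals List Lra Lia Classical_Prop.
From Coquelicot Require Import Coquelicot.
Open Scope R_scope.

(* Start from a horizontal segment and replace its middle fifth by two S-shaped
   horizontal curves, mirror images of each other, whose planar slopes deviate by
   [t]; repeat on all pieces.  The midpoints of the two curves have the same planar
   projection but enclose an area, so their distance is of order [sqrt t], while
   the curves are longer than the segment only by a factor [1 + O (t ^ 2)].  In a
   Hilbert space the parallelogram inequality turns every such diagonal into a gain
   of order [t] in the energy, against a loss of order [t ^ 2]; with [N ^ 2]
   generations and [t = 1 / (2 N)] the total gain [N] beats the bounded loss.  Only
   edges of slope at most [1 / 2] are divided, which keeps the slopes bounded.

   For porosity it is enough to find holes in the planar projection.  It is a union
   of 1-Lipschitz graphs, so it is enough to find holes in each vertical fibre.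
   Because the branching happens far from the end points of a segment, the
   displacements produced along a fibre by successive generations decrease
   geometrically, so the fibre is a lacunary Cantor set, uniformly in [t].

   The set consists of the vertices of such finite constructions, for all [N],
   placed on disjoint segments of the x-axis that shrink to the origin. *)

(** * Planar sets with porous vertical fibres *)

(* [A] is a union of 1-Lipschitz graphs from [(a, ya)] to [(b, yb)], uniformly
   porous in each vertical fibre. *)
Record fibred (A : R -> R -> Prop) (a ya b yb : R) : Prop := {
  fib_lt : a < b;
  fib_dom : forall x y, A x y -> a <= x <= b;
  fib_left : forall y, A a y <-> y = ya;
  fib_right : forall y, A b y <-> y = yb;
  fib_transport : forall x y x', A x y -> a <= x' <= b ->
    exists y', A x' y' /\ Rabs (y' - y) <= Rabs (x' - x);
  fib_porous : forall x y0 r, a <= x <= b -> 0 < r ->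
    exists y1, Rabs (y1 - y0) <= r /\ forall y, A x y -> r / 200 <= Rabs (y - y1)
}.

Lemma fibred_ext (A B : R -> R -> Prop) (a ya b yb : R) :
  (forall x y, A x y <-> B x y) -> fibred A a ya b yb -> fibred B a ya b yb.
Proof.
intros E [H0 H1 H2 H3 H4 H5]; split.
- exact H0.
- intros x y H; apply (H1 x y), E, H.
- intros y; rewrite <- E; apply H2.
- intros y; rewrite <- E; apply H3.
- intros x y x' H Hx'. apply E in H. destruct (H4 x y x' H Hx') as [y' [Hy Hd]].
  exists y'; split; [apply E|]; assumption.
- intros x y0 r Hx Hr. destruct (H5 x y0 r Hx Hr) as [y1 [Hd Hy]].
  exists y1; split; [assumption|]. intros y H; apply Hy, E, H.
Qed.

Lemma far_point (v y0 r : R) : 0 < r ->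
  exists y1, Rabs (y1 - y0) <= r /\ r <= Rabs (v - y1).
Proof.
intros Hr. destruct (Rle_dec v y0).
- exists (y0 + r); split; [apply Rabs_le_between; lra|].
  rewrite Rabs_minus_sym, Rabs_pos_eq; lra.
- exists (y0 - r); split; [apply Rabs_le_between; lra|]. rewrite Rabs_pos_eq; lra.
Qed.

Lemma singleton_porous (P : R -> Prop) (v y0 r : R) : 0 < r -> (forall y, P y -> y = v) ->
  exists y1, Rabs (y1 - y0) <= r /\ forall y, P y -> r / 200 <= Rabs (y - y1).
Proof.
intros Hr HP. destruct (far_point v y0 r Hr) as [y1 [H1 H2]].
exists y1; split; [exact H1|]. intros y Hy. rewrite (HP y Hy). lra.
Qed.

(** The two sets share only the fibre over [b], which is the single point [yb]. A transport across
    [b] passes through that point, and the displacements in x on its two sides add up. *)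
Lemma fibred_glue (A B : R -> R -> Prop) (a ya b yb c yc : R) :
  fibred A a ya b yb -> fibred B b yb c yc ->
  fibred (fun x y => A x y \/ B x y) a ya c yc.
Proof.
intros HA HB.
assert (Hab := fib_lt _ _ _ _ _ HA). assert (Hbc := fib_lt _ _ _ _ _ HB).
assert (dA := fib_dom _ _ _ _ _ HA). assert (dB := fib_dom _ _ _ _ _ HB).
assert (rA := fib_right _ _ _ _ _ HA). assert (lB := fib_left _ _ _ _ _ HB).
split.
- lra.
- intros x y [H|H]; [apply dA in H|apply dB in H]; lra.
- intros y; split.
  + intros [H|H]; [apply (fib_left _ _ _ _ _ HA), H|apply dB in H; lra].
  + intros H; left; apply (fib_left _ _ _ _ _ HA), H.
- intros y; split.
  + intros [H|H]; [apply dA in H; lra|apply (fib_right _ _ _ _ _ HB), H].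
  + intros H; right; apply (fib_right _ _ _ _ _ HB), H.
- intros x y x' H Hx'.
  destruct H as [H|H]; destruct (Rle_dec x' b) as [Hb|Hb].
  + destruct (fib_transport _ _ _ _ _ HA x y x' H) as [y' [? ?]]; [lra|]. exists y'; auto.
  + assert (Hx := dA _ _ H).
    destruct (fib_transport _ _ _ _ _ HA x y b H) as [v [Hv Hd]]; [lra|].
    apply rA in Hv; subst v. assert (Hv : B b yb) by (apply lB; reflexivity).
    destruct (fib_transport _ _ _ _ _ HB b yb x' Hv) as [y' [Hy' Hd']]; [lra|].
    exists y'; split; [auto|].
    rewrite (Rabs_pos_eq (b - x)) in Hd by lra. rewrite (Rabs_pos_eq (x' - b)) in Hd' by lra.
    rewrite (Rabs_pos_eq (x' - x)) by lra. apply Rabs_le_between in Hd, Hd'. apply Rabs_le_between; lra.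
  + assert (Hx := dB _ _ H).
    destruct (fib_transport _ _ _ _ _ HB x y b H) as [v [Hv Hd]]; [lra|].
    apply lB in Hv; subst v. assert (Hv : A b yb) by (apply rA; reflexivity).
    destruct (fib_transport _ _ _ _ _ HA b yb x' Hv) as [y' [Hy' Hd']]; [lra|].
    exists y'; split; [auto|].
    rewrite (Rabs_left1 (b - x)) in Hd by lra. rewrite (Rabs_left1 (x' - b)) in Hd' by lra.
    rewrite (Rabs_left1 (x' - x)) by lra. apply Rabs_le_between in Hd, Hd'. apply Rabs_le_between; lra.
  + destruct (fib_transport _ _ _ _ _ HB x y x' H) as [y' [? ?]]; [lra|]. exists y'; auto.
- intros x y0 r Hx Hr.
  destruct (Rtotal_order x b) as [H|[H|H]].
  + destruct (fib_porous _ _ _ _ _ HA x y0 r) as [y1 [H1 H2]]; [lra|lra|].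
    exists y1; split; [exact H1|]. intros y [Hy|Hy]; [auto|apply dB in Hy; lra].
  + subst x. apply (singleton_porous _ yb); [exact Hr|].
    intros y [Hy|Hy]; [apply rA, Hy|apply lB, Hy].
  + destruct (fib_porous _ _ _ _ _ HB x y0 r) as [y1 [H1 H2]]; [lra|lra|].
    exists y1; split; [exact H1|]. intros y [Hy|Hy]; [apply dA in Hy; lra|auto].
Qed.

(* Only one of the two clusters matters at scales below [d / 4], and at scales
   above [10 d] one can leave both; in between, the clusters are too short to
   be close to both [y0 - d / 4] and [y0 + d / 4]. *)
Lemma two_cluster_porous (P Q : R -> Prop) (v d : R) : 0 <= d ->
  (forall y, P y -> Rabs (y - (v + d)) <= d / 7) ->
  (forall y, Q y -> Rabs (y - (v - d)) <= d / 7) ->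
  (forall y0 r, 0 < r ->
    exists y1, Rabs (y1 - y0) <= r /\ forall y, P y -> r / 200 <= Rabs (y - y1)) ->
  (forall y0 r, 0 < r ->
    exists y1, Rabs (y1 - y0) <= r /\ forall y, Q y -> r / 200 <= Rabs (y - y1)) ->
  forall y0 r, 0 < r ->
    exists y1, Rabs (y1 - y0) <= r /\
      forall y, P y \/ Q y -> r / 200 <= Rabs (y - y1).
Proof.
intros Hd HP HQ pP pQ y0 r Hr.
assert (HP' : forall y, P y -> v + 6 / 7 * d <= y <= v + 8 / 7 * d).
{ intros y Hy. apply HP, Rabs_le_between in Hy. lra. }
assert (HQ' : forall y, Q y -> v - 8 / 7 * d <= y <= v - 6 / 7 * d).
{ intros y Hy. apply HQ, Rabs_le_between in Hy. lra. }
clear HP HQ.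
assert (far : forall y y1, r / 200 <= y - y1 \/ r / 200 <= y1 - y -> r / 200 <= Rabs (y - y1)).
{ intros y y1 H. unfold Rabs; destruct (Rcase_abs (y - y1)); lra. }
destruct (Rle_dec (10 * d) r) as [Hbig|Hbig].
{ destruct (far_point v y0 r Hr) as [y1 [H1 H2]]. exists y1; split; [exact H1|].
  intros y Hy. apply far.
  assert (v - 8 / 7 * d <= y <= v + 8 / 7 * d).
  { destruct Hy as [Hy|Hy]; [apply HP' in Hy|apply HQ' in Hy]; lra. }
  revert H2; unfold Rabs; destruct (Rcase_abs (v - y1)); lra. }
destruct (Rle_dec r (d / 4)) as [Hsmall|Hsmall].
{ destruct (Rle_dec v y0) as [Hv|Hv].
  - destruct (pP y0 r Hr) as [y1 [H1 H2]]. exists y1; split; [exact H1|].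
    apply Rabs_le_between in H1.
    intros y [Hy|Hy]; [auto|]. apply HQ' in Hy. apply far. lra.
  - destruct (pQ y0 r Hr) as [y1 [H1 H2]]. exists y1; split; [exact H1|].
    apply Rabs_le_between in H1.
    intros y [Hy|Hy]; [|auto]. apply HP' in Hy. apply far. lra. }
(* Here [r / 200 < d / 20], while the shift by [d / 4] chosen below leaves a distance of at least
   [3 / 28 * d] to both clusters. *)
destruct (Rle_dec v y0) as [Hv|Hv].
- destruct (Rle_dec y0 (v + d)).
  + exists (y0 - d / 4); split; [apply Rabs_le_between; lra|].
    intros y [Hy|Hy]; [apply HP' in Hy|apply HQ' in Hy]; apply far; lra.
  + exists (y0 + d / 4); split; [apply Rabs_le_between; lra|].
    intros y [Hy|Hy]; [apply HP' in Hy|apply HQ' in Hy]; apply far; lra.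
- destruct (Rle_dec y0 (v - d)).
  + exists (y0 - d / 4); split; [apply Rabs_le_between; lra|].
    intros y [Hy|Hy]; [apply HP' in Hy|apply HQ' in Hy]; apply far; lra.
  + exists (y0 + d / 4); split; [apply Rabs_le_between; lra|].
    intros y [Hy|Hy]; [apply HP' in Hy|apply HQ' in Hy]; apply far; lra.
Qed.

(** In each fibre the two sets are clusters around [v x + d x] and [v x - d x]. Their union is
    porous with the same constant 200 as the parts, so the bound survives any number of
    generations. *)
Lemma fibred_union (A B : R -> R -> Prop) (v d : R -> R) (a ya b yb : R) :
  fibred A a ya b yb -> fibred B a ya b yb ->
  (forall x, a <= x <= b -> 0 <= d x) ->
  (forall x y, A x y -> Rabs (y - (v x + d x)) <= d x / 7) ->
  (forall x y, B x y -> Rabs (y - (v x - d x)) <= d x / 7) ->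
  fibred (fun x y => A x y \/ B x y) a ya b yb.
Proof.
intros HA HB Hd eA eB; split.
- exact (fib_lt _ _ _ _ _ HA).
- intros x y [H|H]; [exact (fib_dom _ _ _ _ _ HA x y H)|exact (fib_dom _ _ _ _ _ HB x y H)].
- intros y. rewrite (fib_left _ _ _ _ _ HA), (fib_left _ _ _ _ _ HB). tauto.
- intros y. rewrite (fib_right _ _ _ _ _ HA), (fib_right _ _ _ _ _ HB). tauto.
- intros x y x' [H|H] Hx'.
  + destruct (fib_transport _ _ _ _ _ HA x y x' H Hx') as [y' [? ?]]. exists y'; auto.
  + destruct (fib_transport _ _ _ _ _ HB x y x' H Hx') as [y' [? ?]]. exists y'; auto.
- intros x y0 r Hx Hr.
  apply (two_cluster_porous (A x) (B x) (v x) (d x)); auto.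
  + intros; apply (fib_porous _ _ _ _ _ HA); auto.
  + intros; apply (fib_porous _ _ _ _ _ HB); auto.
Qed.

Lemma fibred_line (x0 y0 s l : R) : 0 < l -> Rabs s <= 1 ->
  fibred (fun x y => x0 <= x <= x0 + l /\ y = y0 + s * (x - x0)) x0 y0 (x0 + l) (y0 + s * l).
Proof.
intros Hl Hs; split.
- lra.
- intros x y [H _]; exact H.
- intros y; split; [intros [_ ->]; ring|intros ->; split; [lra|ring]].
- intros y; split; [intros [_ ->]; ring|intros ->; split; [lra|ring]].
- intros x y x' [Hx ->] Hx'. exists (y0 + s * (x' - x0)); split; [auto|].
  replace (_ - _) with (s * (x' - x)) by ring. rewrite Rabs_mult.
  assert (H := Rabs_pos (x' - x)). nra.
- intros x v r Hx Hr. apply (singleton_porous _ (y0 + s * (x - x0))); [exact Hr|].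
  intros y [_ H]; exact H.
Qed.

(** * Diamond subdivisions of horizontal segments *)

Record edge : Type := Edge { src : Hpt; slope : R; len : R }.

Definition px (p : Hpt) : R := fst (fst p).
Definition py (p : Hpt) : R := snd (fst p).
Definition pz (p : Hpt) : R := snd p.

(** Right multiplication follows the horizontal lift of a planar segment of slope [s]; [l] measures
    its extent in x, not its length. *)
Definition hstep (p : Hpt) (s l : R) : Hpt := Hmul p (l, s * l, 0).

Definition dst (e : edge) : Hpt := hstep (src e) (slope e) (len e).

(* The two tents of opposite signs both end on the chord, but at different heights:
   the first tent encloses the signed area [- t * h ^ 2]. *)
Definition tent (p : Hpt) (s t h : R) : list edge :=
  Edge p (s + t) h :: Edge (hstep p (s + t) h) (s - t) h :: nil.

Definition tent_end (p : Hpt) (s t h : R) : Hpt := hstep (hstep p (s + t) h) (s - t) h.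

(** Each of the two curves is a tent followed by the opposite tent, so that the areas cancel and
    both curves end at [v]. Their four steps [h] span the middle fifth. *)
Definition subdivide (t : R) (e : edge) : list edge :=
  let (p, s, l) := e in
  let h := l / 20 in
  let u := hstep p s (2 / 5 * l) in
  let v := hstep p s (3 / 5 * l) in
  Edge p s (2 / 5 * l) ::
  (tent u s t h ++ tent u s (- t) h) ++
  (tent (tent_end u s t h) s (- t) h ++ tent (tent_end u s (- t) h) s t h) ++
  Edge v s (2 / 5 * l) :: nil.

Fixpoint leaves (t : R) (n : nat) (e : edge) : list edge :=
  match n with
  | O => e :: nil
  | S k => if Rle_dec (Rabs (slope e)) (1 / 2)
           then flat_map (leaves t k) (subdivide t e) else e :: nil
  end.

Definition vertex (t : R) (n : nat) (e : edge) (p : Hpt) : Prop :=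
  exists e', In e' (leaves t n e) /\ (p = src e' \/ p = dst e').

(** Whole planar segments are kept, not only vertices, so that points can be transported to nearby
    fibres. *)
Definition trace (t : R) (n : nat) (e : edge) (x y : R) : Prop :=
  exists e', In e' (leaves t n e) /\
    px (src e') <= x <= px (src e') + len e' /\
    y = py (src e') + slope e' * (x - px (src e')).

(** * Fibre porosity of the planar traces *)

Lemma trace_subdivide (t : R) (k : nat) (e : edge) (x y : R) : Rabs (slope e) <= 1 / 2 ->
  trace t (S k) e x y <-> exists e', In e' (subdivide t e) /\ trace t k e' x y.
Proof.
intros Hs. unfold trace at 1. simpl leaves.
destruct (Rle_dec (Rabs (slope e)) (1 / 2)) as [_|H]; [|contradiction].
split.
- intros [f [Hf Hxy]]. apply in_flat_map in Hf. destruct Hf as [e' [He' Hf]].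
  exists e'; split; [exact He'|]. exists f; auto.
- intros [e' [He' [f [Hf Hxy]]]]. exists f; split; [|exact Hxy].
  apply in_flat_map. exists e'; auto.
Qed.

Lemma trace_line (t : R) (e : edge) (n : nat) (x y : R) : leaves t n e = e :: nil ->
  trace t n e x y <->
  px (src e) <= x <= px (src e) + len e /\ y = py (src e) + slope e * (x - px (src e)).
Proof.
intros E; unfold trace; rewrite E; split.
- intros [e' [[<-|[]] H]]; exact H.
- intros H; exists e; split; [left; reflexivity|exact H].
Qed.

(** The invariant of the induction on generations: the set stays in a thin rhombus around the chord,
    with opening [t / 7] at both ends. This makes the later displacements small compared with the
    distance between two opposite tents. *)
Definition spindle (t : R) (e : edge) (A : R -> R -> Prop) : Prop :=
  let (p, s, l) := e in
  fibred A (px p) (py p) (px p + l) (py p + s * l) /\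
  forall x y, A x y ->
    Rabs (y - (py p + s * (x - px p))) <= t / 7 * (x - px p) /\
    Rabs (y - (py p + s * (x - px p))) <= t / 7 * (px p + l - x).

(** On each edge only the spindle bound anchored at the foot of the tent is used, not the one at the
    apex; both halves then give the same multiple of the distance to the nearer foot. *)
Lemma tent_fibred (A B : R -> R -> Prop) (t s d h : R) (p : Hpt) :
  spindle t (Edge p (s + d) h) A ->
  spindle t (Edge (hstep p (s + d) h) (s - d) h) B ->
  fibred (fun x y => A x y \/ B x y) (px p) (py p) (px p + 2 * h) (py p + s * (2 * h)) /\
  forall x y, A x y \/ B x y ->
    Rabs (y - (py p + s * (x - px p) + d * Rmin (x - px p) (px p + 2 * h - x)))
    <= (t * Rmin (x - px p) (px p + 2 * h - x)) / 7.
Proof.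
intros [fA eA] [fB eB]. destruct p as [[x0 y0] z0].
unfold px, py in *; simpl in *.
replace (x0 + h + h) with (x0 + 2 * h) in * by ring.
replace (y0 + (s + d) * h + (s - d) * h) with (y0 + s * (2 * h)) in * by ring.
split; [exact (fibred_glue _ _ _ _ _ _ _ _ fA fB)|].
intros x y [H|H].
- assert (D := fib_dom _ _ _ _ _ fA _ _ H). apply eA in H. destruct H as [H _].
  rewrite Rmin_left by lra.
  replace (y0 + s * (x - x0) + d * (x - x0)) with (y0 + (s + d) * (x - x0)) by ring. lra.
- assert (D := fib_dom _ _ _ _ _ fB _ _ H). apply eB in H. destruct H as [_ H].
  rewrite Rmin_right by lra.
  replace (y0 + s * (x - x0) + d * (x0 + 2 * h - x))
    with (y0 + (s + d) * h + (s - d) * (x - (x0 + h))) by ring. lra.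
Qed.

(** The starting points may lie at different heights over one planar point, as happens in the second
    diamond. The final bound is the tent height [t * h] plus a spindle error of one seventh of
    it. *)
Lemma diamond_fibred (A B A' B' : R -> R -> Prop) (t s h : R) (p p' : Hpt) :
  0 < t -> px p = px p' -> py p = py p' ->
  spindle t (Edge p (s + t) h) A ->
  spindle t (Edge (hstep p (s + t) h) (s - t) h) B ->
  spindle t (Edge p' (s + - t) h) A' ->
  spindle t (Edge (hstep p' (s + - t) h) (s - - t) h) B' ->
  fibred (fun x y => (A x y \/ B x y) \/ (A' x y \/ B' x y))
    (px p) (py p) (px p + 2 * h) (py p + s * (2 * h)) /\
  forall x y, (A x y \/ B x y) \/ (A' x y \/ B' x y) ->
    Rabs (y - (py p + s * (x - px p))) <= 8 / 7 * (t * h).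
Proof.
intros Ht Ex Ey gA gB gA' gB'.
destruct (tent_fibred A B t s t h p) as [f1 e1]; auto.
destruct (tent_fibred A' B' t s (- t) h p') as [f2 e2]; auto.
rewrite <- Ex, <- Ey in *.
assert (D1 := fib_dom _ _ _ _ _ f1). assert (D2 := fib_dom _ _ _ _ _ f2).
assert (M : forall x, Rmin (x - px p) (px p + 2 * h - x) <= h).
{ intros x. unfold Rmin; destruct Rle_dec; lra. }
split.
- apply (fibred_union _ _ (fun x => py p + s * (x - px p))
          (fun x => t * Rmin (x - px p) (px p + 2 * h - x))); auto.
  + intros x Hx. apply Rmult_le_pos; [lra|]. apply Rmin_glb; lra.
  + intros x y H. apply e2 in H. rewrite Ropp_mult_distr_l_reverse in H. exact H.
- intros x y H. specialize (M x).
  assert (t * Rmin (x - px p) (px p + 2 * h - x) <= t * h) by (apply Rmult_le_compat_l; lra).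
  destruct H as [H|H]; [apply e1 in H|apply e2 in H]; apply Rabs_le_between in H; apply Rabs_le_between; lra.
Qed.

(** The proportions close the induction: the diamonds deviate from the chord by at most
    [8 / 7 * (t * h)], which equals [t / 7 * (2 / 5 * l)], the opening of the spindle at distance
    [2 / 5 * l] from an end point. The outer pieces lie on the same chord and inherit its bounds. *)
Lemma trace_spindle (t : R) (n : nat) (e : edge) : 0 < t <= 1 / 2 ->
  0 < len e -> Rabs (slope e) <= 1 -> spindle t e (trace t n e).
Proof.
intros Ht.
assert (base : forall n e, 0 < len e -> Rabs (slope e) <= 1 ->
  leaves t n e = e :: nil -> spindle t e (trace t n e)).
{ clear n e. intros n [p s l] Hl Hs E; simpl in Hl, Hs. unfold spindle. split.
  - apply (fibred_ext (fun x y => px p <= x <= px p + l /\ y = py p + s * (x - px p))).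
    + intros x y. rewrite (trace_line t _ n x y E). reflexivity.
    + apply fibred_line; assumption.
  - intros x y H. apply (trace_line t _ n x y E) in H. simpl in H. destruct H as [H ->].
    rewrite Rminus_diag, Rabs_R0. split; apply Rmult_le_pos; lra. }
revert e; induction n as [|n IH]; intros e Hl Hs; [apply base; auto|].
destruct (Rle_dec (Rabs (slope e)) (1 / 2)) as [Ha|Ha].
2:{ apply base; auto. simpl. destruct (Rle_dec (Rabs (slope e)) (1 / 2)); [contradiction|reflexivity]. }
assert (ext := fun x y => trace_subdivide t n e x y Ha).
destruct e as [p s l]; simpl in Hl, Hs, Ha.
assert (Hp : Rabs (s + t) <= 1) by (apply Rabs_le_between in Ha; apply Rabs_le_between; lra).
assert (Hm : Rabs (s - t) <= 1) by (apply Rabs_le_between in Ha; apply Rabs_le_between; lra).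
assert (Hp' : Rabs (s - - t) <= 1) by (apply Rabs_le_between in Ha; apply Rabs_le_between; lra).
assert (Hm' : Rabs (s + - t) <= 1) by (apply Rabs_le_between in Ha; apply Rabs_le_between; lra).
set (h := l / 20) in *. assert (Hh : 0 < h) by (unfold h; lra).
set (u := hstep p s (2 / 5 * l)) in *. set (v := hstep p s (3 / 5 * l)) in *.
set (m := tent_end u s t h). set (m' := tent_end u s (- t) h).
assert (G : forall q s' l', 0 < l' -> Rabs s' <= 1 -> spindle t (Edge q s' l') (trace t n (Edge q s' l'))).
{ intros; apply IH; assumption. }
destruct (diamond_fibred _ _ _ _ t s h u u (proj1 Ht) eq_refl eq_refl
  (G _ _ _ Hh Hp) (G _ _ _ Hh Hm) (G _ _ _ Hh Hm') (G _ _ _ Hh Hp')) as [f1 e1].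
assert (Ex : px m' = px m) by (unfold m, m', tent_end, u; destruct p as [[? ?] ?]; unfold px; simpl; ring).
assert (Ey : py m' = py m) by (unfold m, m', tent_end, u; destruct p as [[? ?] ?]; unfold py; simpl; ring).
(* The order is exchanged because in the second diamond the tent with deviation [t] starts from
   [m']. *)
destruct (diamond_fibred _ _ _ _ t s h m' m (proj1 Ht) Ex Ey
  (G _ _ _ Hh Hp) (G _ _ _ Hh Hm) (G _ _ _ Hh Hm') (G _ _ _ Hh Hp')) as [f2 e2].
destruct (G p s (2 / 5 * l)) as [f0 e0]; [lra|exact Hs|].
destruct (G v s (2 / 5 * l)) as [f3 e3]; [lra|exact Hs|].
assert (Exu : px u = px p + 2 / 5 * l) by (unfold u; destruct p as [[? ?] ?]; unfold px; simpl; ring).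
assert (Eyu : py u = py p + s * (2 / 5 * l)) by (unfold u; destruct p as [[? ?] ?]; unfold py; simpl; ring).
assert (Exv : px v = px p + 3 / 5 * l) by (unfold v; destruct p as [[? ?] ?]; unfold px; simpl; ring).
assert (Eyv : py v = py p + s * (3 / 5 * l)) by (unfold v; destruct p as [[? ?] ?]; unfold py; simpl; ring).
assert (Exm : px m' = px p + l / 2).
{ unfold m', tent_end, u, h; destruct p as [[? ?] ?]; unfold px; simpl; field. }
assert (Eym : py m' = py p + s * (l / 2)).
{ unfold m', tent_end, u, h; destruct p as [[? ?] ?]; unfold py; simpl; field. }
rewrite Exu, Eyu in *. rewrite Exv, Eyv in *. rewrite Exm, Eym in *.
replace (px p + 2 / 5 * l + 2 * h) with (px p + l / 2) in * by (unfold h; field).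
replace (py p + s * (2 / 5 * l) + s * (2 * h)) with (py p + s * (l / 2)) in * by (unfold h; field).
replace (px p + l / 2 + 2 * h) with (px p + 3 / 5 * l) in * by (unfold h; field).
replace (py p + s * (l / 2) + s * (2 * h)) with (py p + s * (3 / 5 * l)) in * by (unfold h; field).
replace (px p + 3 / 5 * l + 2 / 5 * l) with (px p + l) in * by field.
replace (py p + s * (3 / 5 * l) + s * (2 / 5 * l)) with (py p + s * l) in * by field.
assert (D1 := fib_dom _ _ _ _ _ f1). assert (D2 := fib_dom _ _ _ _ _ f2).
assert (D0 := fib_dom _ _ _ _ _ f0). assert (D3 := fib_dom _ _ _ _ _ f3).
assert (F := fibred_glue _ _ _ _ _ _ _ _ f0
  (fibred_glue _ _ _ _ _ _ _ _ f1 (fibred_glue _ _ _ _ _ _ _ _ f2 f3))).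
cbv beta in F.
match type of F with fibred ?A _ _ _ _ =>
  assert (ext' : forall x y, A x y <-> trace t (S n) (Edge p s l) x y) end.
{ intros x y. rewrite ext. simpl. fold h u v m m'. split.
  - intuition (eexists; split; [|eassumption]; tauto).
  - intros [e' [He' H]].
    repeat (destruct He' as [<-|He']; [tauto|]). destruct He'. }
split; [exact (fibred_ext _ _ _ _ _ _ ext' F)|].
intros x y H. apply ext' in H. destruct H as [H|[H|[H|H]]].
- assert (D := D0 _ _ H). apply e0 in H. destruct H as [Ha1 Ha2]. split; [exact Ha1|].
  eapply Rle_trans; [exact Ha2|]. apply Rmult_le_compat_l; lra.
- assert (D := D1 _ _ H). apply e1 in H.
  replace (py p + s * (2 / 5 * l) + s * (x - (px p + 2 / 5 * l))) with (py p + s * (x - px p)) in H by ring.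
  assert (8 / 7 * (t * h) = t / 7 * (2 / 5 * l)) by (unfold h; field).
  split; eapply Rle_trans; try exact H; rewrite H0; apply Rmult_le_compat_l; lra.
- assert (D := D2 _ _ H). apply e2 in H.
  replace (py p + s * (l / 2) + s * (x - (px p + l / 2))) with (py p + s * (x - px p)) in H by ring.
  assert (8 / 7 * (t * h) = t / 7 * (2 / 5 * l)) by (unfold h; field).
  split; eapply Rle_trans; try exact H; rewrite H0; apply Rmult_le_compat_l; lra.
- assert (D := D3 _ _ H). apply e3 in H. destruct H as [Ha1 Ha2].
  replace (py p + s * (3 / 5 * l) + s * (x - (px p + 3 / 5 * l))) with (py p + s * (x - px p)) in * by ring.
  split; [|exact Ha2].
  eapply Rle_trans; [exact Ha1|]. apply Rmult_le_compat_l; lra.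
Qed.

(** * Vertices and a region containing them *)

Lemma vertex_subdivide (t : R) (k : nat) (e e' : edge) (p : Hpt) :
  Rabs (slope e) <= 1 / 2 -> In e' (subdivide t e) ->
  vertex t k e' p -> vertex t (S k) e p.
Proof.
intros Hs He' [f [Hf Hp]]. exists f; split; [|exact Hp]. simpl.
destruct (Rle_dec (Rabs (slope e)) (1 / 2)) as [_|H]; [|contradiction].
apply in_flat_map. exists e'; auto.
Qed.

Lemma src_vertex (t : R) (n : nat) (e : edge) : vertex t n e (src e).
Proof.
revert e; induction n as [|n IH]; intros e.
- exists e; split; [left; reflexivity|auto].
- destruct (Rle_dec (Rabs (slope e)) (1 / 2)) as [Ha|Ha].
  + destruct e as [p s l].
    apply (vertex_subdivide t n (Edge p s l) (Edge p s (2 / 5 * l))); [exact Ha|left; reflexivity|].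
    exact (IH (Edge p s (2 / 5 * l))).
  + exists e; split; [|auto]. simpl. destruct Rle_dec; [contradiction|left; reflexivity].
Qed.

Lemma vertex_trace (t : R) (n : nat) (e : edge) (p : Hpt) :
  (forall e', In e' (leaves t n e) -> 0 < len e') ->
  vertex t n e p -> trace t n e (px p) (py p).
Proof.
intros Hl [e' [He' Hp]]. specialize (Hl e' He'). exists e'; split; [exact He'|].
destruct e' as [[[x y] z] s l]. unfold px, py in *; simpl in *.
destruct Hp as [->| ->]; simpl; split; try lra; ring.
Qed.

(** Chosen to be stable under steps of slope at most 1: since [y] is bounded by [x], a step [l]
    changes the height by at most [x * l], hence by at most the increase [b * l] of the bound. *)
Definition region (b : R) (p : Hpt) : Prop :=
  0 <= px p <= b /\ Rabs (py p) <= px p /\ Rabs (pz p) <= b * px p.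

Definition within (b : R) (e : edge) : Prop :=
  region b (src e) /\ 0 < len e /\ Rabs (slope e) <= 1 /\ px (src e) + len e <= b.

Lemma region_step (b : R) (p : Hpt) (s l : R) : region b p -> 0 <= l -> Rabs s <= 1 ->
  px p + l <= b -> region b (hstep p s l).
Proof.
destruct p as [[x y] z]; unfold region, px, py, pz; simpl.
intros [Hx [Hy Hz]] Hl Hs Hb.
apply Rabs_le_between in Hy, Hz, Hs.
assert (H1 : - l <= s * l <= l) by nra.
generalize dependent (s * l). intros w H1.
assert (H2 : - (x * l) <= x * w <= x * l) by (split; nra).
assert (H3 : - (x * l) <= l * y <= x * l) by (split; nra).
assert (H4 : x * l <= b * l) by (apply Rmult_le_compat_r; lra).
split; [lra|split; apply Rabs_le_between; lra].
Qed.

Lemma px_hstep (p : Hpt) (s l : R) : px (hstep p s l) = px p + l.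
Proof. destruct p as [[x y] z]; reflexivity. Qed.

Lemma subdivide_within (b t : R) (e e' : edge) : 0 < t <= 1 / 2 -> Rabs (slope e) <= 1 / 2 ->
  within b e -> In e' (subdivide t e) -> within b e'.
Proof.
destruct e as [p s l]; intros Ht Hs [Hp [Hl [_ Hb]]] He'; simpl in *.
assert (Hs0 : Rabs s <= 1) by lra.
assert (Hp1 : Rabs (s + t) <= 1) by (apply Rabs_le_between in Hs; apply Rabs_le_between; lra).
assert (Hm : Rabs (s - t) <= 1) by (apply Rabs_le_between in Hs; apply Rabs_le_between; lra).
assert (Hp' : Rabs (s - - t) <= 1) by (apply Rabs_le_between in Hs; apply Rabs_le_between; lra).
assert (Hm' : Rabs (s + - t) <= 1) by (apply Rabs_le_between in Hs; apply Rabs_le_between; lra).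
repeat (destruct He' as [<-|He']; [unfold within, tent_end; simpl;
  split; [repeat (apply region_step; rewrite ?px_hstep; try lra); assumption|];
  split; [lra|split; [assumption|rewrite ?px_hstep; lra]]|]).
destruct He'.
Qed.

Lemma leaves_within (b t : R) (n : nat) (e e' : edge) : 0 < t <= 1 / 2 ->
  within b e -> In e' (leaves t n e) -> within b e'.
Proof.
intros Ht. revert e; induction n as [|n IH]; intros e He H.
- destruct H as [<-|[]]; exact He.
- simpl in H. destruct (Rle_dec (Rabs (slope e)) (1 / 2)) as [Ha|Ha].
  + apply in_flat_map in H. destruct H as [f [Hf H]].
    apply (IH f); [|exact H]. exact (subdivide_within b t e f Ht Ha He Hf).
  + destruct H as [<-|[]]; exact He.
Qed.

Lemma vertex_region (b t : R) (n : nat) (e : edge) (p : Hpt) : 0 < t <= 1 / 2 ->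
  within b e -> vertex t n e p -> region b p.
Proof.
intros Ht He [e' [He' Hp]]. apply (leaves_within b t n e e' Ht He) in He'.
destruct He' as [H1 [H2 [H3 H4]]]. destruct Hp as [->| ->]; [exact H1|].
apply region_step; auto; lra.
Qed.

(** * The energy estimate *)

(* [Q] is a squared Hilbert distance on [X]; [hil_triple] is convexity with the
   weights 2/5, 1/5, 2/5 of the subdivision. *)
Record hilbertian (X : Hpt -> Prop) (Q : Hpt -> Hpt -> R) : Prop := {
  hil_nonneg : forall a b, X a -> X b -> 0 <= Q a b;
  hil_double : forall a b c, X a -> X b -> X c -> Q a c <= 2 * Q a b + 2 * Q b c;
  hil_triple : forall a b c d, X a -> X b -> X c -> X d ->
    Q a d <= 5 / 2 * Q a b + 5 * Q b c + 5 / 2 * Q c d;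
  hil_quad : forall a b c d, X a -> X b -> X c -> X d ->
    Q a c + Q b d <= Q a b + Q b c + Q c d + Q d a
}.

Lemma hstep_hstep_tent (p : Hpt) (s t h : R) :
  tent_end (tent_end p s t h) s (- t) h = hstep p s (4 * h).
Proof.
destruct p as [[x y] z]; unfold tent_end, hstep; simpl. f_equal; [f_equal|]; field.
Qed.

(** The gap is the difference of the opposite areas enclosed by the two tents. Its squared distance
    is [8 * t * h ^ 2], linear in [t]. *)
Lemma tent_end_vertical (p : Hpt) (s t h : R) :
  tent_end p s (- t) h = Hmul (tent_end p s t h) (0, 0, 2 * t * h ^ 2).
Proof.
destruct p as [[x y] z]; unfold tent_end, hstep; simpl. f_equal; [f_equal|]; field.
Qed.

Lemma hstep_hstep (p : Hpt) (s k l : R) : hstep (hstep p s k) s l = hstep p s (k + l).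
Proof.
destruct p as [[x y] z]; unfold hstep; simpl. f_equal; [f_equal|]; field.
Qed.

(* The potential [K (1 + s ^ 2) + A s ^ 2 + n beta] absorbs at each generation the
   lengthening [t ^ 2] of the tents and the gain from the vertical diagonals;
   the term [A s ^ 2] makes it trivially true on the edges left undivided. *)
Lemma energy (X : Hpt -> Prop) (Q : Hpt -> Hpt -> R) (K t A beta : R) :
  hilbertian X Q -> (forall a b, Q a b = Q b a) ->
  0 < K -> 0 < t -> 0 <= A -> beta <= 0 ->
  beta = t ^ 2 / 5 * (K + A) - t / (10 * K) ->
  (forall p s l, X p -> X (hstep p s l) -> 0 < l ->
     Q p (hstep p s l) <= K * (l ^ 2 * (1 + s ^ 2))) ->
  (forall p z, X p -> X (Hmul p (0, 0, z)) -> 0 < z -> 4 * z / K <= Q p (Hmul p (0, 0, z))) ->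
  forall n e, 0 <= A / 4 + INR n * beta -> 0 < len e ->
    (forall p, vertex t n e p -> X p) ->
    X (dst e) /\
    Q (src e) (dst e) <=
      len e ^ 2 * (K * (1 + slope e ^ 2) + A * slope e ^ 2 + INR n * beta).
Proof.
intros HQ Qsym HK Ht HA Hbeta Ebeta Hh Hv.
assert (base : forall n e, 0 < len e -> (forall p, vertex t n e p -> X p) ->
  leaves t n e = e :: nil -> X (dst e) /\
    Q (src e) (dst e) <= len e ^ 2 * (K * (1 + slope e ^ 2))).
{ intros n [p s l] Hl HX E; simpl in Hl |- *.
  assert (X p) by (apply HX; exists (Edge p s l); rewrite E; simpl; auto).
  assert (X (dst (Edge p s l))) by (apply HX; exists (Edge p s l); rewrite E; simpl; auto).
  split; [assumption|].
  assert (H1 := Hh p s l ltac:(assumption) ltac:(assumption) Hl). unfold dst; simpl in *. lra. }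
induction n as [|n IH]; intros e HAn Hl HX.
{ destruct (base 0%nat e Hl HX eq_refl) as [H1 H2]. split; [exact H1|].
  eapply Rle_trans; [exact H2|]. apply Rmult_le_compat_l; [nra|]. simpl INR. nra. }
destruct (Rle_dec (Rabs (slope e)) (1 / 2)) as [Ha|Ha].
2:{ destruct (base (S n) e Hl HX) as [H1 H2].
  { simpl. destruct Rle_dec; [contradiction|reflexivity]. }
  split; [exact H1|].
  eapply Rle_trans; [exact H2|]. apply Rmult_le_compat_l; [nra|].
  assert (1 / 4 <= slope e ^ 2).
  { rewrite <- (pow2_abs (slope e)). nra. }
  nra. }
rewrite S_INR in *. set (nb := INR n * beta) in *.
assert (HAn' : 0 <= A / 4 + nb) by (unfold nb; lra).
assert (sub := fun e' p (He' : In e' (subdivide t e)) Hp => HX p (vertex_subdivide t n e e' p Ha He' Hp)).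
assert (IH' := fun e' (He' : In e' (subdivide t e)) (Hl' : 0 < len e') =>
  IH e' HAn' Hl' (fun p Hp => sub e' p He' Hp)).
assert (srcX := fun e' (He' : In e' (subdivide t e)) => sub e' (src e') He' (src_vertex t n e')).
clear IH sub HX base. destruct e as [p s l]; simpl in Hl, Ha.
set (h := l / 20) in *. assert (Hh0 : 0 < h) by (unfold h; lra).
unfold dst in *; cbn [src slope len] in *.
set (u := hstep p s (2 / 5 * l)) in *. set (v := hstep p s (3 / 5 * l)) in *.
set (m := tent_end u s t h). set (m' := tent_end u s (- t) h).
assert (Ev : tent_end m s (- t) h = v).
{ unfold m. rewrite hstep_hstep_tent. unfold u, v, h. rewrite hstep_hstep. f_equal; field. }
assert (Ev' : tent_end m' s t h = v).
{ unfold m'. rewrite <- (Ropp_involutive t) at 2. rewrite hstep_hstep_tent.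
  unfold u, v, h. rewrite hstep_hstep. f_equal; field. }
assert (Eq : hstep v s (2 / 5 * l) = hstep p s l).
{ unfold v. rewrite hstep_hstep. f_equal; field. }
assert (Em : m' = Hmul m (0, 0, 2 * t * h ^ 2)) by apply tent_end_vertical.
assert (Hl25 : 0 < 2 / 5 * l) by lra.
assert (D : forall q s' l', In (Edge q s' l') (subdivide t (Edge p s l)) -> 0 < l' ->
  X q /\ X (hstep q s' l') /\
  Q q (hstep q s' l') <= l' ^ 2 * (K * (1 + s' ^ 2) + A * s' ^ 2 + nb)).
{ intros q s' l' H Hl'. split; [exact (srcX _ H)|]. exact (IH' (Edge q s' l') H Hl'). }
(* The doubling inequality averages the slopes [s + t'] and [s - t']: the cross terms cancel and
   only [t' ^ 2] is lost. *)
assert (T : forall q t', In (Edge q (s + t') h) (subdivide t (Edge p s l)) ->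
  In (Edge (hstep q (s + t') h) (s - t') h) (subdivide t (Edge p s l)) ->
  X q /\ X (tent_end q s t' h) /\
  Q q (tent_end q s t' h) <= 4 * h ^ 2 * (K * (1 + s ^ 2 + t' ^ 2) + A * (s ^ 2 + t' ^ 2) + nb)).
{ intros q t' I1 I2. destruct (D _ _ _ I1 Hh0) as [X1 [X2 B1]].
  destruct (D _ _ _ I2 Hh0) as [_ [X3 B2]]. fold (tent_end q s t' h) in X3, B2.
  split; [exact X1|split; [exact X3|]].
  assert (B := hil_double _ _ HQ _ _ _ X1 X2 X3). nra. }
clear IH' srcX.
destruct (D p s (2 / 5 * l)) as [Xp [Xu Bu]]; [simpl; tauto|exact Hl25|].
destruct (D v s (2 / 5 * l)) as [Xv [Xq Bq]]; [simpl; tauto|exact Hl25|].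
rewrite Eq in Xq, Bq. fold u in Xu, Bu.
destruct (T u t) as [_ [Xm B1]]; [simpl; tauto|simpl; tauto|].
destruct (T u (- t)) as [_ [Xm' B2]]; [simpl; tauto|simpl; tauto|].
destruct (T m (- t)) as [_ [_ B3]]; [simpl; tauto|simpl; tauto|].
destruct (T m' t) as [_ [_ B4]]; [simpl; tauto|simpl; tauto|].
fold m in Xm, B1. fold m' in Xm', B2. rewrite Ev in B3. rewrite Ev' in B4.
split; [exact Xq|].
assert (V := Hv m (2 * t * h ^ 2)). rewrite <- Em in V.
assert (Hz : 0 < 2 * t * h ^ 2) by (repeat apply Rmult_lt_0_compat; try apply pow_lt; lra).
specialize (V Xm Xm' Hz).
(* The outer pieces have total weight 4/5 and the diamond has [5 * 16 * h ^ 2 = l ^ 2 / 5], so the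
   potential is reproduced with weight 1. What remains is the loss [t ^ 2 / 5 * (K + A)] and, from
   the diagonal between [m] and [m'], the gain [t / (10 * K)]. *)
assert (C1 := hil_triple _ _ HQ _ _ _ _ Xp Xu Xv Xq).
assert (C2 := hil_quad _ _ HQ _ _ _ _ Xu Xm Xv Xm').
rewrite (Qsym v m'), (Qsym m' u) in C2.
assert (E5 : 5 * (4 * (2 * t * h ^ 2) / K) = l ^ 2 * (t / (10 * K))) by (unfold h; field; lra).
assert (Eh : h ^ 2 = l ^ 2 / 400) by (unfold h; field).
rewrite Eh in *. replace ((- t) ^ 2) with (t ^ 2) in * by ring.
replace ((2 / 5 * l) ^ 2) with (4 / 25 * l ^ 2) in * by field.
replace ((INR n + 1) * beta) with (nb + beta) by (unfold nb; ring).
rewrite Ebeta. set (g := t / (10 * K)) in *.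
generalize dependent (l ^ 2). intros l2. intros. lra.
Qed.

(** * Korányi distances *)

Lemma dK_nonneg (p q : Hpt) : 0 <= dK p q.
Proof. destruct p as [[x y] z], q as [[x' y'] z']; apply sqrt_pos. Qed.

Lemma dK_pow4 (x y z x' y' z' : R) :
  dK (x, y, z) (x', y', z') ^ 4 =
  ((x - x') ^ 2 + (y - y') ^ 2) ^ 2 + 16 * (z - z' + / 2 * (x * y' - x' * y)) ^ 2.
Proof.
unfold dK. set (N := _ + _).
assert (HN : 0 <= N) by (unfold N; apply Rplus_le_le_0_compat; [apply pow2_ge_0|];
  apply Rmult_le_pos; [lra|apply pow2_ge_0]).
change 4%nat with (2 * 2)%nat. rewrite pow_mult, pow2_sqrt by apply sqrt_pos.
apply pow2_sqrt, HN.
Qed.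

Lemma pow_lt_inv (a b : R) (n : nat) : 0 <= b -> a ^ n < b ^ n -> a < b.
Proof.
intros Hb H. destruct (Rlt_le_dec a b) as [?|Hab]; [assumption|].
assert (b ^ n <= a ^ n) by (apply pow_incr; lra). lra.
Qed.

Lemma dK_hstep (p : Hpt) (s l : R) : dK p (hstep p s l) ^ 2 = l ^ 2 * (1 + s ^ 2).
Proof.
apply Rsqr_inj; [apply pow2_ge_0|apply Rmult_le_pos; nra|].
unfold Rsqr. transitivity (dK p (hstep p s l) ^ 4); [ring|].
destruct p as [[x y] z]; unfold hstep; simpl Hmul. rewrite dK_pow4. field.
Qed.

Lemma dK_vertical (p : Hpt) (z : R) : 0 <= z -> dK p (Hmul p (0, 0, z)) ^ 2 = 4 * z.
Proof.
intros Hz. apply Rsqr_inj; [apply pow2_ge_0|lra|].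
unfold Rsqr. transitivity (dK p (Hmul p (0, 0, z)) ^ 4); [ring|].
destruct p as [[x y] z0]; simpl Hmul. rewrite dK_pow4. field.
Qed.

(** * Squared distances in l2 *)

Definition sqdist (u v : nat -> R) : R := Series (fun n => (u n - v n) ^ 2).

Lemma ex_series_sqdist (u v : nat -> R) : in_l2 u -> in_l2 v ->
  ex_series (fun n => (u n - v n) ^ 2).
Proof.
unfold in_l2; intros Hu Hv.
apply (ex_series_le (fun n => (u n - v n) ^ 2) (fun n => 2 * u n ^ 2 + 2 * v n ^ 2)).
- intros n. change (Rabs ((u n - v n) ^ 2) <= 2 * u n ^ 2 + 2 * v n ^ 2).
  rewrite Rabs_pos_eq by apply pow2_ge_0. assert (H := pow2_ge_0 (u n + v n)). nra.
- apply (ex_series_plus (fun n => 2 * u n ^ 2) (fun n => 2 * v n ^ 2));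
  [exact (ex_series_scal_l 2 _ Hu)|exact (ex_series_scal_l 2 _ Hv)].
Qed.

Lemma Series_nonneg (a : nat -> R) : ex_series a -> (forall n, 0 <= a n) -> 0 <= Series a.
Proof.
intros Ha Hp. rewrite <- (Rmult_0_l (Series a)), <- Series_scal_l.
apply Series_le; [|exact Ha]. intros n; specialize (Hp n); lra.
Qed.

Lemma sqdist_sym (u v : nat -> R) : sqdist u v = sqdist v u.
Proof. apply Series_ext; intros n; ring. Qed.

(** Each inequality holds term by term. Doubling and the quadrilateral inequality come from the
    squares of [a - 2 b + c] and [a - b + c - d]; the triple inequality is Cauchy-Schwarz with
    [5 / 2 = 1 + 1 / 2 + 1]. *)
Lemma hilbertian_sqdist (X : Hpt -> Prop) (f : Hpt -> nat -> R) :
  (forall p, X p -> in_l2 (f p)) -> hilbertian X (fun a b => sqdist (f a) (f b)).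
Proof.
intros Hf.
assert (E := fun a b Ha Hb => ex_series_sqdist _ _ (Hf a Ha) (Hf b Hb)).
assert (I : forall a b, X a -> X b ->
  is_series (fun n => (f a n - f b n) ^ 2) (sqdist (f a) (f b))).
{ intros; apply Series_correct, E; assumption. }
assert (P : forall (a : nat -> R) l, is_series a l -> (forall n, 0 <= a n) -> 0 <= l).
{ intros a l H Hp. rewrite <- (is_series_unique a l H).
  apply Series_nonneg; [exists l; exact H|exact Hp]. }
assert (S : forall (a b : nat -> R) k l l', is_series a l -> is_series b l' ->
  is_series (fun n => a n + k * b n) (l + k * l')).
{ intros a b k l l' Ha Hb. apply (is_series_plus a (fun n => k * b n)); [exact Ha|].
  apply (is_series_scal_l k b), Hb. }
split.
- intros a b Ha Hb. apply (P _ _ (I a b Ha Hb)). intros n; apply pow2_ge_0.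
- intros a b c Ha Hb Hc.
  assert (H := P _ _ (S _ _ (- (1 / 2)) _ _ (S _ _ 1 _ _ (I a b Ha Hb) (I b c Hb Hc)) (I a c Ha Hc))).
  enough (0 <= sqdist (f a) (f b) + 1 * sqdist (f b) (f c) + - (1 / 2) * sqdist (f a) (f c)) by lra.
  apply H; intros n. assert (G := pow2_ge_0 (f a n - 2 * f b n + f c n)). lra.
- intros a b c d Ha Hb Hc Hd.
  assert (H := P _ _ (S _ _ (- (2 / 5)) _ _ (S _ _ 1 _ _ (S _ _ 2 _ _ (I a b Ha Hb) (I b c Hb Hc))
    (I c d Hc Hd)) (I a d Ha Hd))).
  enough (0 <= sqdist (f a) (f b) + 2 * sqdist (f b) (f c) + 1 * sqdist (f c) (f d)
    + - (2 / 5) * sqdist (f a) (f d)) by lra.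
  apply H; intros n.
  assert (G1 := pow2_ge_0 (f a n - f b n - 2 * (f b n - f c n))).
  assert (G2 := pow2_ge_0 (2 * (f b n - f c n) - (f c n - f d n))).
  assert (G3 := pow2_ge_0 (f a n - f b n - (f c n - f d n))). lra.
- intros a b c d Ha Hb Hc Hd.
  assert (H := P _ _ (S _ _ (-1) _ _ (S _ _ (-1) _ _ (S _ _ 1 _ _ (S _ _ 1 _ _ (S _ _ 1 _ _
    (I a b Ha Hb) (I b c Hb Hc)) (I c d Hc Hd)) (I d a Hd Ha)) (I a c Ha Hc)) (I b d Hb Hd))).
  enough (0 <= sqdist (f a) (f b) + 1 * sqdist (f b) (f c) + 1 * sqdist (f c) (f d)
    + 1 * sqdist (f d) (f a) + -1 * sqdist (f a) (f c) + -1 * sqdist (f b) (f d)) by lra.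
  apply H; intros n. assert (G := pow2_ge_0 (f a n - f b n + f c n - f d n)). lra.
Qed.

(** * The compact set *)

(** The ratio 1/4 keeps the intervals from [width m] to [2 * width m] disjoint. *)
Definition width (m : nat) : R := (/ 4) ^ m.

Definition block_edge (m : nat) : edge := Edge (width m, 0, 0) 0 (width m).

Definition tilt (m : nat) : R := / (2 * INR (S m)).

Definition block (m : nat) : Hpt -> Prop := vertex (tilt m) (S m * S m) (block_edge m).

Definition carpet (p : Hpt) : Prop := p = (0, 0, 0) \/ exists m, block m p.

Lemma width_pos (m : nat) : 0 < width m.
Proof. apply pow_lt; lra. Qed.

Lemma tilt_bounds (m : nat) : 0 < tilt m <= 1 / 2.
Proof.
unfold tilt. rewrite S_INR. assert (H := pos_INR m).
assert (E : / (2 * (INR m + 1)) * (2 * (INR m + 1)) = 1) by (field; lra).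
assert (0 < / (2 * (INR m + 1))) by (apply Rinv_0_lt_compat; lra).
nra.
Qed.

Lemma block_edge_within (m : nat) : within (2 * width m) (block_edge m).
Proof.
assert (H := width_pos m).
split; [|simpl; rewrite Rabs_R0; unfold px; simpl; lra].
unfold region, px, py, pz; simpl. rewrite Rabs_R0. repeat split; try lra.
apply Rmult_le_pos; lra.
Qed.

Lemma block_region (m : nat) (p : Hpt) : block m p -> region (2 * width m) p.
Proof. apply vertex_region; [apply tilt_bounds|apply block_edge_within]. Qed.

Lemma block_near_origin (m : nat) (p : Hpt) : block m p -> dK (0, 0, 0) p < 5 * width m.
Proof.
intros H. apply block_region in H. destruct p as [[x y] z].
unfold region, px, py, pz in H; simpl in H. destruct H as [Hx [Hy Hz]].
assert (Hw := width_pos m). set (w := width m) in *.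
apply (pow_lt_inv _ _ 4); [lra|]. rewrite dK_pow4.
apply Rabs_le_between in Hy, Hz.
(* The fourth power of the distance is at most [(64 + 256) * w ^ 4], below [(5 * w) ^ 4]. *)
assert (H1 : (0 - x) ^ 2 <= 4 * w ^ 2) by nra.
assert (H2 : (0 - y) ^ 2 <= 4 * w ^ 2) by nra.
assert (H3 : - (4 * w ^ 2) <= z <= 4 * w ^ 2) by (split; nra).
assert (H4 : (0 - z + / 2 * (0 * y - x * 0)) ^ 2 <= 16 * w ^ 4).
{ replace (0 - z + / 2 * (0 * y - x * 0)) with (- z) by ring.
  replace (16 * w ^ 4) with ((4 * w ^ 2) ^ 2) by ring.
  replace ((- z) ^ 2) with (z ^ 2) by ring. apply pow_maj_Rabs, Rabs_le_between, H3. }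
assert (H5 : ((0 - x) ^ 2 + (0 - y) ^ 2) ^ 2 <= (8 * w ^ 2) ^ 2).
{ apply pow_incr. split; [apply Rplus_le_le_0_compat; apply pow2_ge_0|lra]. }
assert (0 < w ^ 4) by (apply pow_lt; lra). nra.
Qed.

Lemma finite_cover (I : Type) (U : I -> Hpt -> Prop) (l : list Hpt) :
  (forall p, In p l -> exists i, U i p) ->
  exists l' : list I, forall p, In p l -> exists i, In i l' /\ U i p.
Proof.
induction l as [|a l IH]; intros H.
- exists nil; intros p [].
- destruct (H a (or_introl eq_refl)) as [i Hi].
  destruct IH as [l' Hl']; [intros p Hp; apply H; right; exact Hp|].
  exists (i :: l'). intros p [<-|Hp]; [exists i; simpl; auto|].
  destruct (Hl' p Hp) as [j [Hj Hjp]]. exists j; simpl; auto.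
Qed.

Lemma block_finite (m : nat) : exists l, forall p, block m p <-> In p l.
Proof.
exists (flat_map (fun e => src e :: dst e :: nil) (leaves (tilt m) (S m * S m) (block_edge m))).
intros p. rewrite in_flat_map. unfold block, vertex. simpl In.
split; intros [e [He H]]; exists e; split; auto;
  [destruct H; auto|destruct H as [H|[H|[]]]; auto].
Qed.

Lemma blocks_cover (I : Type) (U : I -> Hpt -> Prop) (k : nat) :
  (forall p, carpet p -> exists i, U i p) ->
  exists l : list I, forall m p, (m < k)%nat -> block m p -> exists i, In i l /\ U i p.
Proof.
intros cov. induction k as [|k [l Hl]].
- exists nil; intros m p H; lia.
- destruct (block_finite k) as [lk Hlk].
  destruct (finite_cover I U lk) as [l' Hl'].
  { intros p Hp. apply cov. right. exists k. apply Hlk, Hp. }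
  exists (l' ++ l). intros m p Hm Hp.
  destruct (Nat.eq_dec m k) as [->|Hne].
  + destruct (Hl' p) as [i [Hi Hip]]; [apply Hlk, Hp|]. exists i; split; [apply in_or_app; auto|auto].
  + destruct (Hl m p) as [i [Hi Hip]]; [lia|exact Hp|]. exists i; split; [apply in_or_app; auto|auto].
Qed.

(** Blocks are finite and shrink to the origin, so a member of the cover around the origin swallows
    all but finitely many of them. *)
Lemma carpet_compact : Hcompact carpet.
Proof.
intros I U Uo cov.
destruct (cov (0, 0, 0)) as [i0 Hi0]; [left; reflexivity|].
destruct (Uo i0 _ Hi0) as [r [Hr HU]].
destruct (pow_lt_1_zero (/ 4)) with (y := r / 5) as [k Hk]; [rewrite Rabs_pos_eq; lra|lra|].
destruct (blocks_cover I U k cov) as [l' Hl'].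
exists (i0 :: l'). intros p [->|[m Hm]]; [exists i0; simpl; auto|].
destruct (Nat.lt_ge_cases m k) as [Hmk|Hmk].
- destruct (Hl' m p Hmk Hm) as [i [Hi Hip]]. exists i; simpl; auto.
- exists i0; split; [simpl; auto|]. apply HU. unfold Hball.
  apply block_near_origin in Hm. specialize (Hk m Hmk).
  rewrite Rabs_pos_eq in Hk by (apply pow_le; lra). unfold width in Hm. lra.
Qed.

(** * Porosity *)

(* The x-axis is added to let the graphs of all blocks extend to the whole line. *)
Definition planar (x y : R) : Prop :=
  y = 0 \/ exists m, trace (tilt m) (S m * S m) (block_edge m) x y.

Lemma carpet_planar (p : Hpt) : carpet p -> planar (px p) (py p).
Proof.
intros [->|[m Hm]]; [left; reflexivity|right]. exists m.
apply vertex_trace; [|exact Hm]. intros e He.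
apply (leaves_within (2 * width m)) in He; [apply He|apply tilt_bounds|apply block_edge_within].
Qed.

Lemma block_fibred (m : nat) :
  fibred (trace (tilt m) (S m * S m) (block_edge m)) (width m) 0 (2 * width m) 0.
Proof.
destruct (trace_spindle (tilt m) (S m * S m) (block_edge m)) as [H _].
- apply tilt_bounds.
- apply width_pos.
- simpl; rewrite Rabs_R0; lra.
- unfold px, py in H; simpl in H.
  replace (width m + width m) with (2 * width m) in H by ring.
  replace (0 + 0 * width m) with 0 in H by ring. exact H.
Qed.

Lemma blocks_disjoint (m m' : nat) (x : R) :
  width m <= x <= 2 * width m -> width m' <= x <= 2 * width m' -> m = m'.
Proof.
assert (lt : forall m m', width m <= x <= 2 * width m -> width m' <= x <= 2 * width m' ->
  ~ (m < m')%nat).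
{ clear. intros m m' H H' L.
  replace m' with (S m + (m' - S m))%nat in H' by lia. unfold width in *.
  rewrite pow_add in H'. simpl in H'.
  assert (A : 0 < (/ 4) ^ m) by (apply pow_lt; lra).
  assert (B : (/ 4) ^ (m' - S m) <= 1 ^ (m' - S m)) by (apply pow_incr; lra).
  rewrite pow1 in B. nra. }
intros H H'. destruct (Nat.lt_total m m') as [L|[E|L]]; [|exact E|].
- exfalso; exact (lt _ _ H H' L).
- exfalso; exact (lt _ _ H' H L).
Qed.

Lemma planar_transport (x y x' : R) : planar x y ->
  exists y', planar x' y' /\ Rabs (y' - y) <= Rabs (x' - x).
Proof.
intros [->|[m H]].
{ exists 0; split; [left; reflexivity|]. rewrite Rminus_diag, Rabs_R0. apply Rabs_pos. }
assert (F := block_fibred m). assert (W := width_pos m).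
assert (D := fib_dom _ _ _ _ _ F _ _ H).
destruct (Rlt_le_dec x' (width m)) as [L|L].
{ destruct (fib_transport _ _ _ _ _ F _ _ (width m) H) as [v [Hv Hd]]; [lra|].
  apply (fib_left _ _ _ _ _ F) in Hv; subst v. exists 0; split; [left; reflexivity|].
  rewrite (Rabs_left1 (width m - x)) in Hd by lra. rewrite (Rabs_left1 (x' - x)) by lra. lra. }
destruct (Rlt_le_dec (2 * width m) x') as [L'|L'].
{ destruct (fib_transport _ _ _ _ _ F _ _ (2 * width m) H) as [v [Hv Hd]]; [lra|].
  apply (fib_right _ _ _ _ _ F) in Hv; subst v. exists 0; split; [left; reflexivity|].
  rewrite (Rabs_pos_eq (2 * width m - x)) in Hd by lra. rewrite (Rabs_pos_eq (x' - x)) by lra. lra. }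
destruct (fib_transport _ _ _ _ _ F _ _ x' H) as [y' [Hy' Hd]]; [lra|].
exists y'; split; [right; exists m; exact Hy'|exact Hd].
Qed.

(** At most one block meets a given fibre. The axis adds the single point 0, which is avoided by
    shifting [y1] by a further [r / 400] away from it. *)
Lemma planar_fibre_porous (x y0 r : R) : 0 < r ->
  exists y1, Rabs (y1 - y0) <= 2 * r /\ forall y, planar x y -> r / 400 <= Rabs (y - y1).
Proof.
intros Hr.
assert (H : exists y1, Rabs (y1 - y0) <= r /\
  forall m y, trace (tilt m) (S m * S m) (block_edge m) x y -> r / 200 <= Rabs (y - y1)).
{ destruct (classic (exists m, width m <= x <= 2 * width m)) as [[m Hm]|N].
  - destruct (fib_porous _ _ _ _ _ (block_fibred m) x y0 r Hm Hr) as [y1 [H1 H2]].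
    exists y1; split; [exact H1|]. intros m' y H.
    assert (D := fib_dom _ _ _ _ _ (block_fibred m') _ _ H).
    rewrite (blocks_disjoint m' m x D Hm) in H. auto.
  - exists y0; split; [rewrite Rminus_diag, Rabs_R0; lra|]. intros m y H. exfalso; apply N.
    exists m. exact (fib_dom _ _ _ _ _ (block_fibred m) _ _ H). }
destruct H as [y1 [H1 H2]]. apply Rabs_le_between in H1.
assert (G : forall d, Rabs d = r / 400 -> r / 400 <= Rabs (0 - (y1 + d)) ->
  Rabs (y1 + d - y0) <= 2 * r /\ forall y, planar x y -> r / 400 <= Rabs (y - (y1 + d))).
{ intros d Hd H0. split.
  - assert (Hd' : Rabs d <= r / 400) by lra. apply Rabs_le_between in Hd'. apply Rabs_le_between; lra.
  - intros y [->|[m Hy]]; [exact H0|]. apply H2 in Hy.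
    assert (T := Rabs_triang (y - (y1 + d)) d).
    replace (y - (y1 + d) + d) with (y - y1) in T by ring. lra. }
destruct (Rle_dec 0 y1) as [Hy|Hy].
- exists (y1 + r / 400). apply G; [apply Rabs_pos_eq; lra|].
  rewrite Rabs_left1; lra.
- exists (y1 + - (r / 400)). apply G; [rewrite Rabs_left1; lra|].
  rewrite Rabs_pos_eq; lra.
Qed.

Lemma dK_planar (x y z x' y' z' r : R) : 0 < r -> dK (x, y, z) (x', y', z') < r ->
  Rabs (x' - x) <= r /\ Rabs (y' - y) <= r /\ Rabs (4 * (z - z' + / 2 * (x * y' - x' * y))) <= r ^ 2.
Proof.
intros Hr H.
assert (H4 : dK (x, y, z) (x', y', z') ^ 4 < r ^ 4).
{ assert (H0 := dK_nonneg (x, y, z) (x', y', z')). set (d := dK _ _) in *.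
  assert (d ^ 2 < r ^ 2) by nra. replace (d ^ 4) with (d ^ 2 * d ^ 2) by ring.
  replace (r ^ 4) with (r ^ 2 * r ^ 2) by ring. assert (0 <= d ^ 2) by apply pow2_ge_0. nra. }
rewrite dK_pow4 in H4. set (w := z - z' + _) in *.
assert (P : 0 <= (x - x') ^ 2) by apply pow2_ge_0.
assert (P' : 0 <= (y - y') ^ 2) by apply pow2_ge_0.
assert (Hr2 : 0 < r ^ 2) by (apply pow_lt; lra).
assert (E : r ^ 4 = r ^ 2 * r ^ 2) by ring.
assert (B : (x - x') ^ 2 + (y - y') ^ 2 <= r ^ 2).
{ assert (0 <= w ^ 2) by apply pow2_ge_0. nra. }
assert (sq : forall a b, 0 <= b -> a ^ 2 <= b ^ 2 -> Rabs a <= b).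
{ intros a b Hb Hab. rewrite <- (Rabs_pos_eq b Hb). apply Rsqr_le_abs_0. unfold Rsqr; lra. }
split; [|split]; apply sq; try lra; nra.
Qed.

(** With [d = r / 8000], a point of the carpet within [d] of the centre would be transported to the
    fibre over [x0], landing within [2 * d] of [y1]; but that fibre avoids [y1] by
    [r / 3200 = 5 / 2 * d]. *)
Lemma carpet_porous : Hporous carpet.
Proof.
exists 8000. split; [lra|]. intros [[x0 y0] z0] _ r Hr.
destruct (planar_fibre_porous x0 y0 (r / 8)) as [y1 [H1 H2]]; [lra|].
(* The centre is reached from the given point by a horizontal step in the y-direction, of length at
   most [r / 4]. *)
exists (Hmul (x0, y0, z0) (0, y1 - y0, 0)). intros [[x y] z] Hq. simpl in Hq. unfold Hball in *.
apply dK_planar in Hq; [|lra]. destruct Hq as [Hx [Hy Hz]].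
set (d := r / 8000) in *. assert (Hd : 0 < d) by (unfold d; lra).
assert (Er : r = 8000 * d) by (unfold d; field).
split.
- apply (pow_lt_inv _ _ 4); [lra|]. rewrite dK_pow4.
  set (a := x - x0). set (b := y - y1). set (t := y1 - y0).
  set (c := z0 + 0 + / 2 * (x0 * (y1 - y0) - 0 * y0) - z + / 2 * ((x0 + 0) * y - x * (y0 + (y1 - y0)))) in *.
  (* Seen from the given point instead of the centre, the vertical term [c] only changes by the area
     [a * t / 2]. *)
  replace (z0 - z + / 2 * (x0 * y - x * y0)) with (c + / 2 * (a * t)) by (unfold a, c, t; field).
  replace (x0 - x) with (- a) by (unfold a; ring).
  replace (y0 - y) with (- (t + b)) by (unfold b, t; ring).
  replace (x - (x0 + 0)) with a in Hx by (unfold a; ring).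
  replace (y - (y0 + (y1 - y0))) with b in Hy by (unfold b; ring).
  fold t in H1. clearbody a b t c. rewrite Er in *. clear Er.
  apply Rabs_le_between in H1, Hx, Hy, Hz.
  replace (2 * (8000 * d / 8)) with (2000 * d) in H1 by field.
  assert (B1 : (- a) ^ 2 + (- (t + b)) ^ 2 <= 5000000 * d ^ 2) by nra.
  assert (B2 : Rabs (c + / 2 * (a * t)) <= 2000 * d ^ 2).
  { apply Rabs_le_between. split; nra. }
  assert (B3 : ((- a) ^ 2 + (- (t + b)) ^ 2) ^ 2 <= (5000000 * d ^ 2) ^ 2).
  { apply pow_incr; split; [apply Rplus_le_le_0_compat; apply pow2_ge_0|exact B1]. }
  assert (B4 := pow_maj_Rabs _ _ 2 B2).
  assert (0 < d ^ 4) by (apply pow_lt; lra). nra.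
- intros Hq. apply carpet_planar in Hq. unfold px, py in Hq; simpl in Hq.
  destruct (planar_transport _ _ x0 Hq) as [y' [Hy' Hd']].
  apply H2 in Hy'.
  replace (x - (x0 + 0)) with (x - x0) in Hx by ring.
  replace (y - (y0 + (y1 - y0))) with (y - y1) in Hy by ring.
  rewrite (Rabs_minus_sym x0 x) in Hd'.
  assert (T := Rabs_triang (y' - y) (y - y1)).
  replace (y' - y + (y - y1)) with (y' - y1) in T by ring. lra.
Qed.

(** * Non-embeddability *)

(** In a block with [N] large compared with [L ^ 4], the energy estimate would make the squared
    distance between the images of the two end points negative. *)
Lemma carpet_not_embeddable (f : Hpt -> nat -> R) : ~ bilip_embed_l2 carpet f.
Proof.
intros [Hf [L [HL Hbi]]].
assert (HQ := hilbertian_sqdist carpet f Hf).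
set (Q := fun a b => sqdist (f a) (f b)) in HQ.
assert (Eq : forall a b, carpet a -> carpet b -> l2dist (f a) (f b) ^ 2 = Q a b).
{ intros a b Ha Hb. apply pow2_sqrt. exact (hil_nonneg _ _ HQ a b Ha Hb). }
set (K := L ^ 2). assert (HK : 1 <= K) by (unfold K; nra).
(* The final bound [K + K / 20 - N / (25 * K)] is negative once [N] exceeds [105 / 4 * K ^ 2]. *)
destruct (INR_unbounded (27 * K ^ 2)) as [m Hm].
set (N := INR (S m)). assert (HN : 27 * K ^ 2 < N) by (unfold N; rewrite S_INR; lra).
assert (HN0 : 0 < N) by nra.
set (t := tilt m). assert (Ht : 0 < t <= 1 / 2) by apply tilt_bounds.
assert (Et : t = / (2 * N)) by reflexivity.
set (i := / K). assert (Hi : 0 < i) by (apply Rinv_0_lt_compat; lra).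
assert (Ei : i * K = 1) by (unfold i; field; lra).
(* [A] must be at least about [N * i / 6] to cover the undivided edges, and well below [N * i] so
   that its loss does not consume the gain. *)
set (A := N * i / 5).
set (beta := t ^ 2 / 5 * (K + A) - t / (10 * K)).
assert (Eb : INR (S m * S m) * beta = K / 20 - N * i / 25).
{ rewrite mult_INR. fold N. unfold beta, A, i. rewrite Et. field. lra. }
assert (HN2 : 27 * K <= N * i).
{ assert (27 * K ^ 2 * i <= N * i) by (apply Rmult_le_compat_r; lra).
  replace (27 * K ^ 2 * i) with (27 * K * (i * K)) in H by ring. rewrite Ei in H. lra. }
assert (Hb : beta <= 0).
{ assert (0 < INR (S m * S m)) by (rewrite mult_INR; fold N; nra). nra. }
assert (HX : forall p, block m p -> carpet p) by (intros p Hp; right; exists m; exact Hp).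
destruct (energy carpet Q K t A beta) with (n := (S m * S m)%nat) (e := block_edge m) as [Hd HE].
- exact HQ.
- intros a b; apply sqdist_sym.
- lra.
- lra.
- unfold A. nra.
- exact Hb.
- reflexivity.
- intros p s l Hp Hq Hl. rewrite <- Eq by assumption.
  rewrite <- dK_hstep with (p := p). unfold K. rewrite <- Rpow_mult_distr.
  apply pow_incr. split; [apply sqrt_pos|]. apply (Hbi p (hstep p s l)); assumption.
- intros p z Hp Hq Hz. rewrite <- Eq by assumption.
  rewrite <- dK_vertical with (p := p) by lra. unfold K.
  replace (dK p (Hmul p (0, 0, z)) ^ 2 / L ^ 2) with ((/ L * dK p (Hmul p (0, 0, z))) ^ 2) by (field; lra).
  apply pow_incr. split; [|apply (Hbi p (Hmul p (0, 0, z))); assumption].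
  apply Rmult_le_pos; [apply Rlt_le, Rinv_0_lt_compat; lra|apply dK_nonneg].
- rewrite Eb. unfold A. lra.
- apply width_pos.
- exact HX.
- rewrite Eb in HE. simpl slope in HE.
  assert (Hs : carpet (src (block_edge m))) by (apply HX, src_vertex).
  assert (H0 := hil_nonneg _ _ HQ _ _ Hs Hd).
  assert (W : 0 < len (block_edge m) ^ 2) by (apply pow_lt, width_pos).
  assert (K * (1 + 0 ^ 2) + A * 0 ^ 2 + (K / 20 - N * i / 25) < 0) by lra.
  nra.
Qed.

Theorem theorem1p4 :
  exists X : Hpt -> Prop,
    Hcompact X /\ Hporous X /\ ~ (exists f : Hpt -> nat -> R, bilip_embed_l2 X f).
Proof.
exists carpet. split; [exact carpet_compact|split; [exact carpet_porous|]].
intros [f Hf]. exact (carpet_not_embeddable f Hf).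
Qed.
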